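(* Let $(\tau_1,\tau_2)$ be the pair of termination times of the chains $(M_1,M_2)$ with parameters $(\bm{\alpha},\bm{P},\bm{U},\bm{Q}_1,\bm{Q}_2)$, and let $\tau_{1,2}$ be their common exit time from $\mathcal{E}$. For integers $n_1,n_2\ge 2$, $m,z_1,z_2\ge 1$ and $i\in\mathcal{E}$ define $$f_{\tau_1,\tau_2}(n_1,n_2):=\mathbb{P}(\tau_1=n_1,\tau_2=n_2),\qquad f_{\tau_1,\tau_2|M_1,M_2}(n_1,n_2|i):=\mathbb{P}(\tau_1=n_1,\tau_2=n_2\mid M_1(0)=M_2(0)=i),$$ $$\psi(m,z_1,z_2):=\mathbb{P}(\tau_{1,2}=m,\ \tau_1-\tau_{1,2}=z_1,\ \tau_2-\tau_{1,2}=z_2),$$ $$\psi_i(m,z_1,z_2):=\mathbb{P}(\tau_{1,2}=m,\ \tau_1-\tau_{1,2}=z_1,\ \tau_2-\tau_{1,2}=z_2\mid M_1(0)=M_2(0)=i).$$ Then $$f_{\tau_1,\tau_2}(n_1,n_2)=\sum_{m=1}^{\min\{n_1,n_2\}-1}\psi(m,n_1-m,n_2-m),\qquad f_{\tau_1,\tau_2|M_1,M_2}(n_1,n_2|i)=\sum_{m=1}^{\min\{n_1,n_2\}-1}\psi_i(m,n_1-m,n_2-m),$$ and $$\psi(m,z_1,z_2)=\bm{\alpha}\bm{P}^{m-1}\bm{U}\left((\bm{Q}_1^{z_1-1}\bm{q}_1)\odot(\bm{Q}_2^{z_2-1}\bm{q}_2)\right),\qquad \psi_i(m,z_1,z_2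)=\bm{e}_i^{\intercal}\bm{P}^{m-1}\bm{U}\left((\bm{Q}_1^{z_1-1}\bm{q}_1)\odot(\bm{Q}_2^{z_2-1}\bm{q}_2)\right).$$
   Context: Construction. $\mathcal{E}$ and $\mathcal{S}$ are disjoint nonempty finite sets. $\bm{\alpha}$ is a probability row vector indexed by $\mathcal{E}$; $\bm{P}$ is a subprobability matrix (nonnegative entries, row sums at most $1$) on $\mathcal{E}$; $\bm{U}$ is a nonnegative $\mathcal{E}\times\mathcal{S}$ matrix such that each row of $(\bm{P}\ \bm{U})$ sums to one; $\bm{Q}_1,\bm{Q}_2$ are subprobability matrices on $\mathcal{S}$; $\bm{q}_k=\bm{1}-\bm{Q}_k\bm{1}$ for $k\in\{1,2\}$, where $\bm{1}$ is a column vector of ones. All chains terminate almost surely (from every state), i.e. all eigenvalues of $\bm{P},\bm{Q}_1,\bm{Q}_2$ have modulus strictly less than $1$. $M_1$ is a terminating Markov chain (time $n=0,1,2,\dots$) on $\mathcal{E}\cup\mathcal{S}$ with initial vector $(\bm{\alpha},\bm{0})$ and subprobability transition matrix $\begin{pmatrix}\bm{P}&\bm{U}\\ \bm{0}&\bm{Q}_1\end{pmatrix}$ (the missing mass in a row is the probability of terminating at the next step). Let $\tau_{1,2}:=\inf\{n\ge 1: M_1(n)\notin\mathcal{E}\}$. Set $M_2(n)=M_1(n)$ for $n\le\tau_{1,2}$; after time $\tau_{1,2}$, given the past up to $\tau_{1,2}$, $M_2$ evolves independently of $M_1$ as a terminating Markov chain in $\mathcal{S}$ with subprobability matrix $\bm{Q}_2$.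 For $k\in\{1,2\}$, $\tau_k:=\inf\{n\ge 1: M_k(n)\notin\mathcal{E}\cup\mathcal{S}\}$ (termination time). Notation: $\bm{e}_i$ is the $i$-th canonical column vector, $\odot$ is the entrywise (Hadamard) product of vectors, zeroth powers of matrices are the identity. Conditioning on $M_1(0)=M_2(0)=i$ means the law of the process started from state $i$ (i.e. $\bm{\alpha}$ replaced by $\bm{e}_i^\intercal$). *)

(* Defs.v *)
From HB Require Import structures.
From mathcomp Require Import all_boot all_order all_algebra.
From mathcomp Require Import all_classical all_reals all_analysis.
From mathcomp Require Import complex.

Set Implicit Arguments.
Unset Strict Implicit.
Unset Printing Implicit Defensive.

Import Order.TTheory GRing.Theory Num.Theory.

Local Open Scope classical_set_scope.
Local Open Scope ring_scope.

(* A matrix on a finite set X is a matrix of size #|X|, whose row and column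
   of x : X have index enum_rank x.  The disjoint union of the two sets of
   states is the sum type E + S, and a process that may terminate takes its
   values in option X, where None is the state "terminated". *)

Definition prob_row (R : realType) (n : nat) (v : 'rV[R]_n) : Prop :=
  (forall j, 0 <= v 0 j) /\ \sum_j v 0 j = 1.

Definition nonneg_mx (R : realType) (m n : nat) (A : 'M[R]_(m, n)) : Prop :=
  forall i j, 0 <= A i j.

Definition subprob_mx (R : realType) (n : nat) (A : 'M[R]_n) : Prop :=
  nonneg_mx A /\ forall i, \sum_j A i j <= 1.

(* All complex eigenvalues have modulus less than one: for a subprobability
   matrix, almost sure termination from every state. *)
Definition terminates (R : realType) (n : nat) (A : 'M[R]_n) : Prop :=
  forall z : complex R,
    eigenvalue (map_mx (real_complex R) A) z -> `|z| < 1.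

(* The transpose of the canonical column vector e_i. *)
Definition unit_row (R : realType) (E : finType) (i : E) : 'rV[R]_#|E| :=
  delta_mx 0 (enum_rank i).

Definition exit_vec (R : realType) (n : nat) (Q : 'M[R]_n) : 'cV[R]_n :=
  const_mx 1 - Q *m const_mx 1.

Definition hadamard (R : realType) (m n : nat) (A B : 'M[R]_(m, n)) :
  'M[R]_(m, n) := map2_mx *%R A B.

(* Index of a state of E + S in block matrices. *)
Definition block_rank (E S : finType) (x : E + S) : 'I_(#|E| + #|S|) :=
  match x with
  | inl a => lshift #|S| (enum_rank a)
  | inr b => rshift #|E| (enum_rank b)
  end.

Definition init1 (R : realType) (E S : finType) (alpha : 'rV[R]_#|E|)
  (x : E + S) : R :=
  row_mx alpha (0 : 'rV[R]_#|S|) 0 (block_rank x).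

Definition trans1 (R : realType) (E S : finType) (P : 'M[R]_#|E|)
  (U : 'M[R]_(#|E|, #|S|)) (Q1 : 'M[R]_#|S|) (x y : E + S) : R :=
  block_mx P U 0 Q1 (block_rank x) (block_rank y).

Definition trans2 (R : realType) (S : finType) (Q2 : 'M[R]_#|S|)
  (x y : S) : R :=
  Q2 (enum_rank x) (enum_rank y).

(* The missing mass of each row is the probability of terminating at the next
   step; a terminated chain remains terminated. *)
Definition term_kernel (R : realType) (X : finType) (p : X -> X -> R)
  (x y : option X) : R :=
  match x, y with
  | Some a, Some b => p a b
  | Some a, None => 1 - \sum_b p a b
  | None, Some _ => 0
  | None, None => 1
  end.

Definition follows (Om X : Type) (M : nat -> Om -> X) (n : nat)
  (x : nat -> X) : set Om :=
  [set w | forall k, (k <= n)%N -> M k w = x k].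

(* The identity Pr(A /\ B) = Pr(A) Pr(B | A) expresses the Markov property
   with no restriction to paths of positive probability. *)
Definition terminating_chain (R : realType) (d : measure_display)
  (Om : measurableType d) (pr : probability Om R) (X : finType)
  (M : nat -> Om -> option X) (v : X -> R) (p : X -> X -> R) : Prop :=
  (forall x, pr [set w | M 0%N w = Some x] = (v x)%:E) /\
  (forall n (x : nat -> option X),
    pr (follows M n.+1 x) =
      (pr (follows M n x) * (term_kernel p (x n) (x n.+1))%:E)%E).

(* First time n >= 1 outside of A, equal to +oo if there is none. *)
Definition exit_time (R : realType) (Om X : Type) (A : set X)
  (M : nat -> Om -> X) (w : Om) : \bar R :=
  ereal_inf [set (n%:R)%:E | n in [set n | (1 <= n)%N /\ ~ A (M n w)]].

Definition in_E (E S : Type) : set (option (E + S)) :=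
  [set x | exists a : E, x = Some (inl a)].

Definition in_ES (E S : Type) : set (option (E + S)) :=
  [set x | exists a : E + S, x = Some a].

Definition tau12 (R : realType) (Om E S : Type)
  (M1 : nat -> Om -> option (E + S)) : Om -> \bar R :=
  exit_time R (@in_E E S) M1.

Definition tau (R : realType) (Om E S : Type)
  (M : nat -> Om -> option (E + S)) : Om -> \bar R :=
  exit_time R (@in_ES E S) M.

(* The events "tau12 = m, M1(0) = x 0, ..., M1(m) = x m" are the atoms of the
   past up to tau12 on {tau12 < +oo}. *)
Definition past (R : realType) (Om E S : Type)
  (M1 : nat -> Om -> option (E + S)) (m : nat)
  (x : nat -> option (E + S)) : set Om :=
  [set w | tau12 R M1 w = (m%:R)%:E] `&` follows M1 m x.

Definition follows_after (Om X : Type) (M : nat -> Om -> X) (m l : nat)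
  (y : nat -> X) : set Om :=
  follows (fun k => M (m + k)%N) l y.

Record coupled_chains (R : realType) (E S : finType) (alpha : 'rV[R]_#|E|)
  (P : 'M[R]_#|E|) (U : 'M[R]_(#|E|, #|S|)) (Q1 Q2 : 'M[R]_#|S|)
  (d : measure_display) (Om : measurableType d) (pr : probability Om R)
  (M1 M2 : nat -> Om -> option (E + S)) : Prop := CoupledChains {
  cc_meas1 : forall n x, measurable [set w | M1 n w = x];
  cc_meas2 : forall n x, measurable [set w | M2 n w = x];
  cc_law1 : terminating_chain pr M1 (@init1 R E S alpha) (trans1 P U Q1);
  cc_common : forall n w, ((n%:R)%:E <= tau12 R M1 w)%E -> M2 n w = M1 n w;
  (* Given the past up to tau12, M2 moves in S according to Q2. *)
  cc_law2 : forall m (x : nat -> option (E + S)) l (z : nat -> option S),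
    pr (past R M1 m x `&` follows_after M2 m l.+1 (fun k => omap inr (z k))) =
    (pr (past R M1 m x `&` follows_after M2 m l (fun k => omap inr (z k))) *
      (term_kernel (trans2 Q2) (z l) (z l.+1))%:E)%E;
  (* Given the past up to tau12, M1 and M2 are independent after tau12; the
     quotients by the probability of the past are cleared. *)
  cc_indep : forall m (x : nat -> option (E + S)) l
      (y z : nat -> option (E + S)),
    (pr (past R M1 m x) *
      pr (past R M1 m x `&`
        (follows_after M1 m l y `&` follows_after M2 m l z)) =
     pr (past R M1 m x `&` follows_after M1 m l y) *
      pr (past R M1 m x `&` follows_after M2 m l z))%E
}.

Definition joint_pmf (R : realType) (E S : finType) (d : measure_display)
  (Om : measurableType d) (pr : probability Om R)
  (M1 M2 : nat -> Om -> option (E + S)) (n1 n2 : nat) : \bar R :=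
  pr [set w | tau R M1 w = (n1%:R)%:E /\ tau R M2 w = (n2%:R)%:E].

(* On {tau12 = +oo} the differences are -oo, so the event excludes it. *)
Definition psi (R : realType) (E S : finType) (d : measure_display)
  (Om : measurableType d) (pr : probability Om R)
  (M1 M2 : nat -> Om -> option (E + S)) (m z1 z2 : nat) : \bar R :=
  pr [set w | [/\ tau12 R M1 w = (m%:R)%:E,
                 (tau R M1 w - tau12 R M1 w)%E = (z1%:R)%:E &
                 (tau R M2 w - tau12 R M1 w)%E = (z2%:R)%:E]].

(* Main.v *)
Require Import Defs.
From HB Require Import structures.
From mathcomp Require Import all_boot all_order all_algebra.
From mathcomp Require Import all_classical all_reals all_analysis.

Set Implicit Arguments.
Unset Strict Implicit.
Unset Printing Implicit Defensive.

Import Order.TTheory GRing.Theory Num.Theory.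

Local Open Scope ring_scope.

(** On the event that the common exit time [tau12] equals [m], the first chain
sits at time [m] almost surely in some state [s] of [S], together with the
second one. From there the two chains are conditionally independent, and each
dies after exactly [z] further steps with probability [(Q ^+ (z - 1) *m
exit_vec Q) s]. Hence the joint conditional probability is the [s]-entry of the
Hadamard product, while [(alpha *m P ^+ (m - 1) *m U) s] is the probability of
exiting from [E] at time [m] into [s]. Summing over [s] gives the matrix
formula ([psi_formula]), and splitting [tau1 = n1, tau2 = n2] according to the
value of [tau12] gives the convolution ([joint_formula]).

The Markov property and the conditional independence are hypotheses about
single trajectories ([follows]), whereas exit and death times are events of the
form: each of the first [l + 1] coordinates lies in a prescribed set ([box]).
The state space being finite, a box is a finite disjoint union of
trajectories, so that identities linear in the trajectories extend to boxes
([mass_box], [indep_box]), and the Markov property becomes a one-step recursion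
on boxes ([box_massS]).  Matrix powers come out of this recursion: powers of [P]
before the exit ([box_mass_before], [box_mass_exit]), powers of [Q1] or [Q2]
after it ([mass_dies]).

Two points need care.  The law of [M2] after [tau12] is known only along
trajectories in [S] and the terminated state; since those already carry the
whole mass, the other trajectories are null ([M2_avoids_E]), and [M2] too is
Markov for a kernel on [E + S] ([markov_M2_after]).  The chain [M1] can
terminate directly from [E] only with probability zero, because [alpha] and the
rows of [(P U)] sum to one; this removes the term [m = n1] from the
convolution. *)

Local Open Scope classical_set_scope.

(** * Exit times *)

Lemma exit_timeP (R : realType) (Om X : Type) (A : set X)
  (M : nat -> Om -> X) (w : Om) (n : nat) :
  exit_time R A M w = (n%:R)%:E <->
  [/\ (1 <= n)%N, ~ A (M n w) &
      forall k, (1 <= k)%N -> (k < n)%N -> A (M k w)].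
Proof.
rewrite /exit_time; set V := [set _ | _ in _].
have first_exit k : (1 <= k)%N -> ~ A (M k w) ->
    (forall j, (1 <= j)%N -> (j < k)%N -> A (M j w)) ->
    ereal_inf V = (k%:R)%:E.
  move=> k1 Mk ltk; apply/eqP; rewrite eq_le; apply/andP; split.
    by apply: ereal_inf_lbound; exists k.
  apply: le_ereal_inf_tmp => _ [j [j1 Mj] <-].
  rewrite lee_fin ler_nat leqNgt; apply/negP => jk; exact/Mj/ltk.
split=> [infV|[]]; last exact: first_exit.
have [[k [k1 Mk]]|noexit] :=
    pselect (exists k, (1 <= k)%N /\ ~ A (M k w)); last first.
  suff V0 : V = set0 by move: infV; rewrite V0 ereal_inf0.
  apply/seteqP; split=> // y [k [k1 Mk] _]; apply: noexit; by exists k.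
have ex : exists k, (1 <= k)%N && `[< ~ A (M k w) >].
  by exists k; rewrite k1; apply/asboolP.
case: (ex_minnP ex) => j /andP[j1 /asboolP Mj] minj.
have ltj i : (1 <= i)%N -> (i < j)%N -> A (M i w).
  move=> i1 ij; have [//|Mi] := pselect (A (M i w)).
  by move: ij; rewrite ltnNge minj// i1; apply/asboolP.
move: infV; rewrite (first_exit j)// => -[/eqP].
by rewrite eqr_nat => /eqP <-.
Qed.

(** * Finite-horizon events of a process with finitely many states *)

Section Paths.
Context {R : realType} {d : measure_display} {Om : measurableType d}.
Variable pr : probability Om R.

(** All events are of finite probability, so that sums and products can be
computed in [R] rather than in the extended reals. *)
Definition mass (A : set Om) : R := fine (pr A).

Lemma massE A : measurable A -> pr A = (mass A)%:E.
Proof. by move=> mA; rewrite /mass fineK// fin_num_measure. Qed.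

Lemma mass0 : mass set0 = 0.
Proof. by rewrite /mass measure0. Qed.

Lemma mass_ge0 A : 0 <= mass A.
Proof. by rewrite /mass fine_ge0. Qed.

Lemma le_mass A B : measurable A -> measurable B -> A `<=` B ->
  mass A <= mass B.
Proof.
move=> mA mB AB; rewrite -lee_fin -!massE//; apply: le_measure => //;
  exact/mem_set.
Qed.

Lemma mass_sum (I : finType) (Q : pred I) (F : I -> set Om) :
  (forall i, measurable (F i)) -> (forall i j w, F i w -> F j w -> i = j) ->
  mass (\bigcup_(i in [set` Q]) F i) = \sum_(i | Q i) mass (F i).
Proof.
move=> mF dF; rewrite /mass measure_fin_bigcup//; last first.
  by move=> i j _ _ [w []]; exact: dF.
rewrite -(@bigfs _ _ _ _ (index_enum I)) ?index_enum_uniq//; last first.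
  by move=> i _; rewrite mem_index_enum.
rewrite (eq_bigr (fun i => (mass (F i))%:E)) ?sumEFin// => i _.
exact: massE.
Qed.

Lemma measurable_coords (Y : finType) (X : nat -> Om -> Y)
    (Q : nat -> Y -> Prop) :
  (forall k y, measurable [set w | X k w = y]) ->
  measurable [set w | forall k, Q k (X k w)].
Proof.
move=> mX.
suff -> : [set w | forall k, Q k (X k w)] =
    \bigcap_k \bigcup_(y in [set y | Q k y]) [set w | X k w = y].
  apply: bigcapT_measurable => k; apply: fin_bigcup_measurable => //.
apply/seteqP; split=> w /= Qw.
  by move=> k _; exists (X k w) => //=; exact: Qw.
by move=> k; have [y /= Qy ->] := Qw k I.
Qed.

Definition box (Y : Type) (X : nat -> Om -> Y) (l : nat)
    (B : nat -> pred Y) : set Om :=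
  [set w | forall k, (k <= l)%N -> B k (X k w)].

Section Coordinates.
Context {Y : finType}.
Variable X : nat -> Om -> Y.
Hypothesis mX : forall k y, measurable [set w | X k w = y].

Lemma measurable_box l B : measurable (box X l B).
Proof. exact: (measurable_coords (fun k y => (k <= l)%N -> B k y)). Qed.

Lemma measurable_follows l x : measurable (follows X l x).
Proof. exact: (measurable_coords (fun k y => (k <= l)%N -> y = x k)). Qed.

Lemma eq_follows l (x y : nat -> Y) : (forall k, (k <= l)%N -> x k = y k) ->
  follows X l x = follows X l y.
Proof. by move=> xy; apply/seteqP; split=> w Xw k kl; rewrite Xw// xy. Qed.

Lemma mass_value C k (Q : pred Y) : measurable C ->
  mass (C `&` [set w | Q (X k w)]) =
  \sum_(y | Q y) mass (C `&` [set w | X k w = y]).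
Proof.
move=> mC; rewrite -mass_sum.
- congr mass; apply/seteqP; split=> [w [Cw Qw]|w [y /= Qy [Cw Xw]]].
    by exists (X k w).
  by split=> //=; rewrite Xw.
- by move=> y; apply: measurableI.
- by move=> y y' w [_ /= <-] [_ /= <-].
Qed.

(** The hypotheses on the chains speak of infinite sequences, of which only the
values up to the horizon matter; [inord] makes the others arbitrary. *)
Definition path_of l (f : {ffun 'I_l.+1 -> Y}) : nat -> Y :=
  fun k => f (inord k).

(** This is what transports hypotheses about trajectories to boxes. *)
Lemma mass_box C l B : measurable C ->
  mass (C `&` box X l B) =
  \sum_(f : {ffun 'I_l.+1 -> Y} | [forall k : 'I_l.+1, B k (f k)])
     mass (C `&` follows X l (path_of f)).
Proof.
move=> mC; rewrite -mass_sum.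
- congr mass; apply/seteqP; split=> [w [Cw Bw]|w [f /= /forallP Bf [Cw Xw]]].
    exists [ffun k : 'I_l.+1 => X k w].
      by apply/forallP => k; rewrite ffunE; apply: Bw; rewrite -ltnS.
    by split=> // k kl; rewrite /path_of ffunE inordK.
  split=> // k kl; rewrite Xw// /path_of.
  by have := Bf (inord k); rewrite inordK.
- by move=> f; apply: measurableI => //; exact: measurable_follows.
- move=> f g w [_ Xf] [_ Xg]; apply/ffunP => k.
  have kl : (k <= l)%N by rewrite -ltnS.
  by have := Xf k kl; rewrite Xg// /path_of inord_val.
Qed.


Definition box_mass A B l y :=
  mass (A `&` [set w | X l w = y] `&` box X l B).

Lemma box_mass0 A B y : measurable A ->
  box_mass A B 0 y = (B 0%N y)%:R * mass (A `&` [set w | X 0%N w = y]).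
Proof.
move=> mA; rewrite /box_mass; have [By|By] := boolP (B 0%N y).
  rewrite mul1r; congr mass; apply/seteqP; split=> [w []//|w [Aw Xw]].
  by split=> // k; rewrite leqn0 => /eqP ->; rewrite Xw.
rewrite mul0r -mass0; congr mass; apply/seteqP; split=> // w [[_ Xw] Bw].
by have := Bw _ (leqnn _); rewrite Xw (negbTE By).
Qed.

Lemma mass_box_split A B l : measurable A ->
  mass (A `&` box X l B) = \sum_y box_mass A B l y.
Proof.
move=> mA; have mAB : measurable (A `&` box X l B).
  by apply: measurableI => //; exact: measurable_box.
have := mass_value l predT mAB.
rewrite (_ : _ `&` [set w | _] = A `&` box X l B); last first.
  by apply/seteqP; split=> // w [].
by move=> ->; apply: eq_bigr => y _; rewrite setIAC.
Qed.

(** Grouping the trajectories by their last state turns a sum over paths into a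
sum over states. *)
Lemma sum_path_last (A : set Om) (B : nat -> pred Y) l (g : Y -> R) :
  measurable A ->
  \sum_(f : {ffun 'I_l.+1 -> Y} | [forall k : 'I_l.+1, B k (f k)])
     mass (A `&` follows X l (path_of f)) * g (path_of f l) =
  \sum_y box_mass A B l y * g y.
Proof.
move=> mA.
have mAy y : measurable (A `&` [set w | X l w = y]) by exact: measurableI.
under [RHS]eq_bigr do rewrite /box_mass mass_box// big_distrl/=.
rewrite exchange_big/=; apply: eq_bigr => f _.
rewrite (bigD1 (path_of f l))//= big1 ?addr0 => [|z zf].
  congr (mass _ * _); rewrite -setIA; congr (A `&` _).
  by apply/seteqP; split=> [w fw|w []//]; split=> //; exact: fw.
rewrite (_ : _ `&` _ `&` _ = set0) ?mass0 ?mul0r//.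
apply/seteqP; split=> // w [[_ /= Xw] fw].
by move: zf; rewrite -(fw l)// Xw eqxx.
Qed.

Definition markov_on A (K : Y -> Y -> R) := forall l x,
  mass (A `&` follows X l.+1 x) =
  mass (A `&` follows X l x) * K (x l) (x l.+1).

(** In the Markov property only the last state of a trajectory is seen by the
kernel, so the sum over all trajectories in the box factors through the
distribution of the last state. *)
Lemma box_massS A K B l y : measurable A -> markov_on A K ->
  box_mass A B l.+1 y =
  (B l.+1 y)%:R * \sum_y' box_mass A B l y' * K y' y.
Proof.
move=> mA markovA; rewrite {1}/box_mass.
have [By|By] := boolP (B l.+1 y); last first.
  rewrite mul0r -mass0; congr mass; apply/seteqP; split=> // w [[_ Xw] Bw].
  by have := Bw _ (leqnn _); rewrite Xw (negbTE By).
have -> : A `&` [set w | X l.+1 w = y] `&` box X l.+1 B =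
    A `&` [set w | X l.+1 w = y] `&` box X l B.
  apply/seteqP; split=> w [[Aw Xw] Bw]; split=> // k kl.
    exact/Bw/leqW.
  by move: kl; rewrite leq_eqVlt => /predU1P[->|/Bw//]; rewrite Xw.
rewrite mul1r mass_box//; last exact: measurableI.
rewrite -(sum_path_last _ _ (fun y' => K y' y))//.
apply: eq_bigr => f _.
transitivity (mass (A `&` follows X l.+1
    (fun k => if (k <= l)%N then path_of f k else y))).
  congr mass; apply/seteqP; split=> w.
    move=> [[Aw Xw] fw]; split=> // k; rewrite leq_eqVlt.
    by case/predU1P=> [->|kl]; rewrite ?ltnn// -ltnS kl fw.
  move=> [Aw fw]; split; first split=> //=.
    by have := fw _ (leqnn _); rewrite ltnn.
  by move=> k kl; have := fw k (leqW kl); rewrite kl.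
rewrite markovA leqnn ltnn; congr (mass (A `&` _) * _).
by apply: eq_follows => k ->.
Qed.

End Coordinates.

(** Both sides are bilinear in the two families of trajectories.  The identity
is kept free of quotients so as to include events [A] of mass zero. *)
Lemma indep_box (Y : finType) (X X' : nat -> Om -> Y) A l B B' :
  (forall k y, measurable [set w | X k w = y]) ->
  (forall k y, measurable [set w | X' k w = y]) ->
  measurable A ->
  (forall y z, mass A * mass (A `&` (follows X l y `&` follows X' l z)) =
     mass (A `&` follows X l y) * mass (A `&` follows X' l z)) ->
  mass A * mass (A `&` (box X l B `&` box X' l B')) =
  mass (A `&` box X l B) * mass (A `&` box X' l B').
Proof.
move=> mX mX' mA indepA.
rewrite [in RHS](mass_box mX)// [X in _ = _ * X](mass_box mX')//.
rewrite setIA setIAC (mass_box mX); last first.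
  by apply: measurableI => //; exact: measurable_box.
rewrite big_distrl big_distrr; apply: eq_bigr => f _ /=.
rewrite setIAC (mass_box mX'); last first.
  by apply: measurableI => //; exact: measurable_follows.
rewrite !big_distrr; apply: eq_bigr => g _ /=.
by rewrite -indepA setIA.
Qed.

End Paths.

(** * The block kernel on E + S *)

Lemma sum_enum_val (V : zmodType) (T : finType) (F : T -> V) :
  \sum_x F x = \sum_(j < #|T|) F (enum_val j).
Proof.
rewrite (reindex_onto enum_val enum_rank) => [|x _]; last exact: enum_rankK.
by apply: eq_bigl => j; rewrite enum_valK eqxx.
Qed.

Lemma sum_states (V : zmodType) (E S : finType) (F : option (E + S) -> V) :
  \sum_y F y = F None +
    (\sum_(j < #|E|) F (Some (inl (enum_val j))) +
     \sum_(j < #|S|) F (Some (inr (enum_val j)))).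
Proof.
rewrite (bigD1 None)//= (reindex_omap Some id); last by case.
rewrite (eq_bigl predT) => [|x]; last by rewrite /= eqxx.
by rewrite big_sumType/=; congr (_ + (_ + _)); exact: sum_enum_val.
Qed.

Section Kernel.
Context {R : realType} {E S : finType}.
Variables (P : 'M[R]_#|E|) (U : 'M[R]_(#|E|, #|S|)) (Q : 'M[R]_#|S|).

Lemma trans1_EE a b :
  trans1 P U Q (inl a) (inl b) = P (enum_rank a) (enum_rank b).
Proof. exact: block_mxEul. Qed.

Lemma trans1_ES a b :
  trans1 P U Q (inl a) (inr b) = U (enum_rank a) (enum_rank b).
Proof. exact: block_mxEur. Qed.

Lemma trans1_SE a b : trans1 P U Q (inr a) (inl b) = 0.
Proof. by rewrite /trans1 block_mxEdl mxE. Qed.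

Lemma trans1_SS a b :
  trans1 P U Q (inr a) (inr b) = Q (enum_rank a) (enum_rank b).
Proof. exact: block_mxEdr. Qed.

(** The missing mass of a row of [E] is one minus the row sum of [(P U)]. *)
Lemma kernel_E_None a : (forall i, \sum_j row_mx P U i j = 1) ->
  term_kernel (trans1 P U Q) (Some (inl a)) None = 0.
Proof.
move=> hPU /=; rewrite -[X in X - _](hPU (enum_rank a)); apply/eqP.
rewrite subr_eq0 big_split_ord big_sumType; apply/eqP.
congr (_ + _); rewrite [RHS]sum_enum_val; apply: eq_bigr => j _.
  by rewrite row_mxEl trans1_EE enum_valK.
by rewrite row_mxEr trans1_ES enum_valK.
Qed.

Lemma kernel_S_None s :
  term_kernel (trans1 P U Q) (Some (inr s)) None = exit_vec Q (enum_rank s) 0.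
Proof.
rewrite /= /exit_vec [RHS]mxE mxE [in RHS]mxE mxE.
rewrite big_sumType/= big1 ?add0r => [|a _]; last first.
  exact: trans1_SE.
congr (1 - _); rewrite [LHS]sum_enum_val; apply: eq_bigr => j _.
by rewrite mxE mulr1 trans1_SS enum_valK.
Qed.

(** The terminating kernel of [Q] on [S] is the restriction of the block kernel
to states outside of [E]; hence the same computation serves both chains after
the exit. *)
Lemma term_kernel_trans2 (a b : option S) :
  term_kernel (trans2 Q) a b =
  term_kernel (trans1 P U Q) (omap inr a) (omap inr b).
Proof.
case: a b => [a|] [b|] //=; first by rewrite trans1_SS.
congr (1 - _); rewrite big_sumType/= [X in X + _]big1 ?add0r => [|e _].
  by apply: eq_bigr => s _; rewrite trans1_SS.
exact: trans1_SE.
Qed.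

End Kernel.

(** * Death of a chain started in S *)

Section Absorption.
Context {R : realType} {d : measure_display} {Om : measurableType d}.
Variable pr : probability Om R.
Context {E S : finType}.
Variables (P : 'M[R]_#|E|) (U : 'M[R]_(#|E|, #|S|)) (Q : 'M[R]_#|S|).
Variable X : nat -> Om -> option (E + S).
Hypothesis mX : forall k y, measurable [set w | X k w = y].
Variables (A : set Om) (s : S).
Hypothesis mA : measurable A.
Hypothesis startA : A `<=` [set w | X 0%N w = Some (inr s)].
Hypothesis markovA : markov_on pr X A (term_kernel (trans1 P U Q)).

Definition dies_at z k (y : option (E + S)) :=
  ((k < z)%N ==> isSome y) && ((k == z) ==> ~~ isSome y).

(** As long as the chain lives it stays in [S], where one step of the recursion
is one multiplication by [Q]. *)
Lemma box_mass_alive z k : (k < z)%N ->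
  [/\ box_mass pr X A (dies_at z) k None = 0,
      forall e, box_mass pr X A (dies_at z) k (Some (inl e)) = 0 &
      forall j, box_mass pr X A (dies_at z) k (Some (inr (enum_val j))) =
        mass pr A * (Q ^+ k) (enum_rank s) j].
Proof.
elim: k => [|k IHk] kz.
  have start0 y : y <> Some (inr s) ->
      mass pr (A `&` [set w | X 0%N w = y]) = 0.
    move=> ys; rewrite (_ : _ `&` _ = set0) ?mass0//.
    apply/seteqP; split=> // w [Aw /= Xw]; apply: ys.
    by rewrite -Xw; exact: startA.
  split=> [|e|j]; rewrite box_mass0//.
  - by rewrite start0 ?mulr0.
  - by rewrite start0 ?mulr0.
  rewrite /dies_at kz (ltn_eqF kz) mul1r expr0 !mxE.
  case: eqVneq => [<-|sj].
    rewrite enum_rankK mulr1; congr mass; apply/seteqP; split=> [w []//|w Aw].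
    by split=> //; exact: startA.
  rewrite mulr0 start0// => -[ej]; case/eqP: sj.
  by rewrite -ej enum_valK.
have {IHk}[IHn IHe IHs] := IHk (ltnW kz).
have step y : box_mass pr X A (dies_at z) k.+1 y =
    (isSome y)%:R * \sum_(j < #|S|) mass pr A * (Q ^+ k) (enum_rank s) j *
       term_kernel (trans1 P U Q) (Some (inr (enum_val j))) y.
  rewrite (box_massS mX _ _ _ mA markovA) sum_states IHn mul0r add0r.
  rewrite big1 ?add0r => [|e _]; last by rewrite IHe mul0r.
  rewrite {1}/dies_at kz (ltn_eqF kz) andbT; congr (_ * _).
  by apply: eq_bigr => j _; rewrite IHs.
split=> [|e|j]; rewrite step ?mul0r ?mul1r//.
  by rewrite big1// => j _; rewrite /= trans1_SE mulr0.
rewrite exprSr -mulmxE mxE big_distrr; apply: eq_bigr => i _ /=.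
by rewrite trans1_SS !enum_valK mulrA.
Qed.

(** The terminated state is absorbing, so the horizon [l] may be taken as large
as wanted: this allows a common horizon for two chains with different death
times. *)
Lemma box_mass_dead z l : (z < l)%N ->
  (box_mass pr X A (dies_at z.+1) l None =
     mass pr A * (Q ^+ z *m exit_vec Q) (enum_rank s) 0) /\
  (forall b, box_mass pr X A (dies_at z.+1) l (Some b) = 0).
Proof.
elim: l => // l IHl; rewrite ltnS leq_eqVlt => /predU1P[<-|zl].
  have [IHn IHe IHs] := box_mass_alive (leqnn z.+1).
  split=> [|b]; rewrite (box_massS mX _ _ _ mA markovA) {1}/dies_at ltnn eqxx/=;
    last by rewrite mul0r.
  rewrite mul1r sum_states IHn mul0r add0r big1 ?add0r => [|e _]; last first.
    by rewrite IHe mul0r.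
  rewrite mxE big_distrr; apply: eq_bigr => j _.
  by rewrite IHs kernel_S_None enum_valK -mulrA.
have [IHn IHb] := IHl zl.
split=> [|b]; rewrite (box_massS mX _ _ _ mA markovA) /dies_at.
  rewrite ltnS ltnNge (ltnW zl)/= gtn_eqF//= mul1r sum_states IHn mulr1.
  by rewrite !big1 ?addr0// => j _; rewrite IHb mul0r.
rewrite sum_states IHn mulr0 !big1 ?addr0 ?mulr0// => j _;
  by rewrite IHb mul0r.
Qed.

Lemma mass_dies z l : (z < l)%N ->
  mass pr (A `&` box X l (dies_at z.+1)) =
  mass pr A * (Q ^+ z *m exit_vec Q) (enum_rank s) 0.
Proof.
move=> zl; have [dead alive] := box_mass_dead zl.
rewrite (mass_box_split pr mX)// sum_states dead !big1 ?addr0//.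
Qed.

End Absorption.

(** * The coupled chains up to the common exit time *)

Section Coupled.
Context {R : realType} {E S : finType}.
Variables (alpha : 'rV[R]_#|E|) (P : 'M[R]_#|E|) (U : 'M[R]_(#|E|, #|S|)).
Variables (Q1 Q2 : 'M[R]_#|S|).
Context {d : measure_display} {Om : measurableType d}.
Variable pr : probability Om R.
Variables M1 M2 : nat -> Om -> option (E + S).
Hypothesis halpha : prob_row alpha.
Hypothesis hPU : forall i, \sum_j row_mx P U i j = 1.
Hypothesis hM : coupled_chains alpha P U Q1 Q2 pr M1 M2.

Local Notation mass := (mass pr).

Definition is_E (y : option (E + S)) : bool :=
  if y is Some (inl _) then true else false.

Lemma is_EP y : in_E y <-> is_E y.
Proof. by split=> [[a ->]//|]; case: y => [[a|]|]// _; exists a. Qed.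

Lemma is_someP y : @in_ES E S y <-> isSome y.
Proof. by split=> [[a ->]//|]; case: y => [a|]// _; exists a. Qed.

(** Time [0] is left free, because exit times start at [1]. *)
Definition exits_at (a : pred (option (E + S))) n k y :=
  ((0 < k < n)%N ==> a y) && ((k == n) ==> ~~ a y).

Lemma exit_time_box (A : set (option (E + S))) (a : pred (option (E + S)))
    (M : nat -> Om -> option (E + S)) n :
  (forall y, A y <-> a y) -> (1 <= n)%N ->
  [set w | exit_time R A M w = (n%:R)%:E] = box M n (exits_at a n).
Proof.
move=> Aa n1; apply/seteqP; split=> w /=; rewrite exit_timeP.
  move=> [_ An ltn] k; rewrite leq_eqVlt => /predU1P[->|kn].
    rewrite /exits_at ltnn andbF eqxx /=; apply/negP; by rewrite -Aa.
  rewrite /exits_at (ltn_eqF kn) kn !andbT; apply/implyP => k0.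
  by rewrite -Aa; exact: ltn.
move=> Bw; split=> // [|k k1 kn].
  have := Bw n (leqnn n); rewrite /exits_at ltnn andbF eqxx /= => /negP.
  by rewrite -Aa.
have := Bw k (ltnW kn); rewrite /exits_at k1 kn => /andP[+ _].
by rewrite Aa.
Qed.

Lemma tau12_box m : (1 <= m)%N ->
  [set w | tau12 R M1 w = (m%:R)%:E] = box M1 m (exits_at is_E m).
Proof. by move=> m1; apply: exit_time_box => //; exact: is_EP. Qed.

Lemma tau_box (M : nat -> Om -> option (E + S)) n : (1 <= n)%N ->
  [set w | tau R M w = (n%:R)%:E] = box M n (exits_at isSome n).
Proof. by move=> n1; apply: exit_time_box => //; exact: is_someP. Qed.

Let mM1 : forall n y, measurable [set w | M1 n w = y] := cc_meas1 hM.
Let mM2 : forall n y, measurable [set w | M2 n w = y] := cc_meas2 hM.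

Lemma markov_M1 : markov_on pr M1 setT (term_kernel (trans1 P U Q1)).
Proof.
move=> l x; rewrite !setTI; apply: EFin_inj; rewrite EFinM -!massE.
- exact: (cc_law1 hM).2.
- exact: measurable_follows.
- exact: measurable_follows.
Qed.

Lemma mass_M1_0 x : mass [set w | M1 0%N w = Some x] = init1 alpha x.
Proof.
by apply: EFin_inj; rewrite -massE//; exact: (cc_law1 hM).1.
Qed.

Lemma mass_M1_0_inl j :
  mass [set w | M1 0%N w = Some (inl (enum_val j))] = alpha 0 j.
Proof. by rewrite mass_M1_0 /init1 row_mxEl enum_valK. Qed.

Lemma mass_M1_0_inr s : mass [set w | M1 0%N w = Some (inr s)] = 0.
Proof. by rewrite mass_M1_0 /init1 row_mxEr mxE. Qed.

(** The entries of [alpha] already sum to one. *)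
Lemma mass_M1_0_None : mass [set w | M1 0%N w = None] = 0.
Proof.
have := mass_value pr mM1 0 predT (@measurableT _ Om).
rewrite (_ : _ `&` _ = setT); last by apply/seteqP.
rewrite {1}/mass probability_setT sum_states !setTI.
under [X in _ + (X + _)]eq_bigr do rewrite setTI mass_M1_0_inl.
under [X in _ + (_ + X)]eq_bigr do rewrite setTI mass_M1_0_inr.
rewrite halpha.2 big1// addr0 /= => /eqP.
by rewrite -subr_eq subrr => /eqP.
Qed.

(** Before the exit the chain moves inside [E], where one step is one
multiplication by [P]. *)
Lemma box_mass_before m k : (k < m)%N ->
  [/\ box_mass pr M1 setT (exits_at is_E m) k None = 0,
      forall s, box_mass pr M1 setT (exits_at is_E m) k (Some (inr s)) = 0 &
      forall j,
        box_mass pr M1 setT (exits_at is_E m) k (Some (inl (enum_val j))) =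
        (alpha *m P ^+ k) 0 j].
Proof.
elim: k => [|k IHk] km.
  split=> [|s|j]; rewrite box_mass0// setTI.
  - by rewrite mass_M1_0_None mulr0.
  - by rewrite mass_M1_0_inr mulr0.
  by rewrite mass_M1_0_inl /exits_at (ltn_eqF km) mul1r expr0 mulmx1.
have {IHk}[IHn IHs IHe] := IHk (ltnW km).
have step y : box_mass pr M1 setT (exits_at is_E m) k.+1 y =
    (is_E y)%:R * \sum_(j < #|E|) (alpha *m P ^+ k) 0 j *
       term_kernel (trans1 P U Q1) (Some (inl (enum_val j))) y.
  rewrite (box_massS mM1 _ _ _ measurableT markov_M1) sum_states IHn.
  rewrite mul0r add0r [X in _ + X]big1 ?addr0 => [|s _]; last first.
    by rewrite IHs mul0r.
  congr (_ * _); first by rewrite /exits_at km (ltn_eqF km) /= andbT.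
  by apply: eq_bigr => j _; rewrite IHe.
split=> [|s|j]; rewrite step ?mul0r ?mul1r//.
rewrite exprSr -mulmxE mulmxA mxE; apply: eq_bigr => i _.
by rewrite /= trans1_EE !enum_valK.
Qed.

Lemma box_mass_exit m :
  box_mass pr M1 setT (exits_at is_E m.+1) m.+1 None = 0 /\
  forall j,
    box_mass pr M1 setT (exits_at is_E m.+1) m.+1 (Some (inr (enum_val j))) =
    (alpha *m P ^+ m *m U) 0 j.
Proof.
have [IHn IHs IHe] := box_mass_before (leqnn m.+1).
have step y : ~~ is_E y -> box_mass pr M1 setT (exits_at is_E m.+1) m.+1 y =
    \sum_(j < #|E|) (alpha *m P ^+ m) 0 j *
       term_kernel (trans1 P U Q1) (Some (inl (enum_val j))) y.
  move=> yE; rewrite (box_massS mM1 _ _ _ measurableT markov_M1) sum_states IHn.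
  rewrite mul0r add0r [X in _ + X]big1 ?addr0 => [|s _]; last first.
    by rewrite IHs mul0r.
  rewrite {1}/exits_at ltnn eqxx yE mul1r.
  by apply: eq_bigr => j _; rewrite IHe.
split=> [|j]; rewrite step//.
  by rewrite big1// => j _; rewrite kernel_E_None// mulr0.
by rewrite mxE; apply: eq_bigr => i _; rewrite /= trans1_ES !enum_valK.
Qed.

(** * The coupled chains after the common exit time *)

Lemma past_box m x : (1 <= m)%N ->
  past R M1 m x = box M1 m (exits_at is_E m) `&` follows M1 m x.
Proof. by move=> m1; rewrite /past tau12_box. Qed.

Lemma measurable_past m x : (1 <= m)%N -> measurable (past R M1 m x).
Proof.
move=> m1; rewrite past_box//.
by apply: measurableI; [exact: measurable_box|exact: measurable_follows].
Qed.

Lemma past_follows m x : (1 <= m)%N ->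
  (forall k, (k <= m)%N -> exits_at is_E m k (x k)) ->
  past R M1 m x = follows M1 m x.
Proof.
move=> m1 xB; rewrite past_box//; apply/seteqP; split=> [w []//|w xw].
by split=> // k km; rewrite xw// xB.
Qed.

(** The past up to [tau12 = m] followed by [l] further states is a single
trajectory of length [m + l], so the Markov property of [M1] applies to it. *)
Lemma markov_M1_after m x : (1 <= m)%N ->
  markov_on pr (fun k => M1 (m + k)%N) (past R M1 m x)
    (term_kernel (trans1 P U Q1)).
Proof.
move=> m1 l y.
have [E0|/set0P[w0 [pw0 yw0]]] := eqVneq
    (past R M1 m x `&` follows (fun k => M1 (m + k)%N) l y) set0.
  rewrite E0 mass0 mul0r (_ : _ `&` _ = set0) ?mass0//.
  apply/seteqP; split=> // w [pw yw]; rewrite -E0; split=> // k kl.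
  exact/yw/leqW.
(* When the conditioning event is not empty, a point [w0] of it certifies that
   this concatenated path leaves [E] exactly at time [m]. *)
pose x' k := if (k <= m + l)%N then M1 k w0 else y (k - m)%N.
have pastE w : (forall k, (k <= m)%N -> M1 k w = M1 k w0) <->
    past R M1 m x w.
  move: pw0; rewrite past_box// => -[Bw0 xw0]; split=> [ww0|[_ xw] k km].
    by split=> k km; rewrite ww0//; [exact: Bw0|exact: xw0].
  by rewrite xw// xw0.
have cylE j : (l <= j <= l.+1)%N ->
    past R M1 m x `&` follows (fun k => M1 (m + k)%N) j y =
    setT `&` follows M1 (m + j) x'.
  move=> /andP[lj jl]; rewrite setTI; apply/seteqP; split=> w.
    move=> [/pastE pw yw] k kmj; rewrite /x'.
    case: (leqP k m) => [km|mk].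
      by rewrite (leq_trans km (leq_addr _ _)) pw.
    rewrite -[in LHS](subnKC (ltnW mk)) yw ?leq_subLR//.
    case: leqP => // kml; rewrite -[in RHS](subnKC (ltnW mk)) yw0//.
    by rewrite leq_subLR.
  move=> xw; split.
    apply/pastE => k km; rewrite xw ?(leq_trans km (leq_addr _ _))// /x'.
    by rewrite (leq_trans km (leq_addr _ _)).
  move=> k kj; rewrite xw ?leq_add2l// /x' leq_add2l addKn.
  by case: leqP => // kl; rewrite yw0.
rewrite !cylE ?leqnn ?leqnSn ?leqnn// addnS markov_M1; congr (_ * _).
rewrite /x' leqnn ltnn subSn ?leq_addr// addKn; congr term_kernel.
by rewrite yw0.
Qed.

Lemma sum_term_kernel (X : finType) (p : X -> X -> R) x :
  \sum_y term_kernel p x y = 1.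
Proof.
rewrite (bigD1 None)//= (reindex_omap Some id); last by case.
rewrite (eq_bigl predT) => [|y]; last by rewrite /= eqxx.
by case: x => [a|] /=; [rewrite subrK|rewrite big1 ?addr0].
Qed.

Lemma M2_at_exit m x w : past R M1 m x w -> forall k, (k <= m)%N ->
  M2 k w = M1 k w.
Proof.
move=> [t12 _] k km; apply: (cc_common hM).
by rewrite t12 lee_fin ler_nat.
Qed.

Lemma kernel_to_E (Q : 'M[R]_#|S|) y e : ~~ is_E y ->
  term_kernel (trans1 P U Q) y (Some (inl e)) = 0.
Proof. by case: y => [[|s]|]//= _; exact: trans1_SE. Qed.

Lemma law_M2_after m x l (z : nat -> option (E + S)) : (1 <= m)%N ->
  (forall k, (k <= l.+1)%N -> ~~ is_E (z k)) ->
  mass (past R M1 m x `&` follows (fun k => M2 (m + k)%N) l.+1 z) =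
  mass (past R M1 m x `&` follows (fun k => M2 (m + k)%N) l z) *
    term_kernel (trans1 P U Q2) (z l) (z l.+1).
Proof.
move=> m1 zS.
pose z' k := if z k is Some (inr s) then Some s else None.
have zE k : (k <= l.+1)%N -> z k = omap inr (z' k).
  by move=> /zS; rewrite /z'; case: (z k) => [[]|].
have mA j y : measurable
    (past R M1 m x `&` follows (fun k => M2 (m + k)%N) j y).
  apply: measurableI; first exact: measurable_past.
  by apply: measurable_follows => k; exact: mM2.
rewrite (eq_follows _ zE) (eq_follows _ (fun k kl => zE k (leqW kl))).
rewrite !zE// -term_kernel_trans2.
apply: EFin_inj; rewrite EFinM -!massE//; exact: (cc_law2 hM).
Qed.

(** Given a trajectory outside of [E], the next steps outside of [E] have
conditional probabilities that sum to one, which leaves no mass for a step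
into [E]. *)
Lemma M2_avoids_E m x l (z : nat -> option (E + S)) : (1 <= m)%N ->
  (exists2 k, (k <= l)%N & is_E (z k)) ->
  mass (past R M1 m x `&` follows (fun k => M2 (m + k)%N) l z) = 0.
Proof.
move=> m1.
have mM2' k y : measurable [set w | M2 (m + k)%N w = y] by exact: mM2.
have mA j y : measurable
    (past R M1 m x `&` follows (fun k => M2 (m + k)%N) j y).
  by apply: measurableI; [exact: measurable_past|exact: measurable_follows].
elim: l z => [|l IHl] z [k kl zk].
  rewrite (_ : _ `&` _ = set0) ?mass0//; apply/seteqP; split=> // w [pw zw].
  move: zk; move: kl; rewrite leqn0 => /eqP ->; rewrite -zw// addn0.
  rewrite (M2_at_exit pw)//; move: pw; rewrite past_box// => -[Bw _].
  by have := Bw m (leqnn m); rewrite /exits_at ltnn andbF eqxx /= => /negP.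
have [[j jl zj]|noE] := pselect (exists2 j, (j <= l)%N & is_E (z j)).
  apply/eqP; rewrite eq_le mass_ge0 andbT -(IHl z); last by exists j.
  by apply: le_mass => // w [pw zw]; split=> // i il; exact/zw/leqW.
have zS j : (j <= l)%N -> ~~ is_E (z j).
  by move=> jl; apply/negP => zj; apply: noE; exists j.
pose zy y j := if (j <= l)%N then z j else y.
pose A := past R M1 m x `&` follows (fun k => M2 (m + k)%N) l z.
have stepE y : A `&` [set w | M2 (m + l.+1)%N w = y] =
    past R M1 m x `&` follows (fun k => M2 (m + k)%N) l.+1 (zy y).
  rewrite -setIA; congr (_ `&` _); apply/seteqP; split=> w.
    move=> [zw lw] j; rewrite leq_eqVlt /zy => /predU1P[->|].
      by rewrite ltnn.
    by rewrite ltnS => jl; rewrite jl zw.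
  move=> zw; split=> [j jl|]; last by have := zw _ (leqnn _); rewrite /zy ltnn.
  by have := zw j (leqW jl); rewrite /zy jl.
(* [p] is the actual distribution of the next state and [q] the one predicted
   by the kernel: equal outside of [E], with equal totals, hence equal on [E],
   where [q] vanishes. *)
pose p y := mass (A `&` [set w | M2 (m + l.+1)%N w = y]).
pose q y := mass A * term_kernel (trans1 P U Q2) (z l) y.
have pq y : ~~ is_E y -> p y = q y.
  move=> yS; rewrite /p stepE law_M2_after//; last first.
    by move=> j _; rewrite /zy; case: leqP => // /zS.
  rewrite /zy leqnn ltnn; congr (mass (_ `&` _) * _).
  by apply: eq_follows => j ->.
have sumpq : \sum_y p y = \sum_y q y.
  rewrite /q -[RHS]big_distrr/= sum_term_kernel mulr1.
  have := mass_value pr mM2' l.+1 predT (mA l z).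
  rewrite (_ : _ `&` [set w | _] = A); first by move=> ->.
  by apply/seteqP; split=> // w [].
have p0 : \sum_(y | is_E y) p y = 0.
  move: sumpq; rewrite (bigID is_E)/= [RHS](bigID is_E)/= (eq_bigr _ pq).
  move=> /addIr ->; apply: big1 => -[[e|//]|//] _.
  by rewrite /q kernel_to_E ?mulr0// zS.
have zl : is_E (z l.+1).
  move: kl zk; rewrite leq_eqVlt => /predU1P[->//|].
  by rewrite ltnS => /zS/negP.
rewrite (_ : _ `&` _ = A `&` [set w | M2 (m + l.+1)%N w = z l.+1]); last first.
  rewrite stepE; congr (_ `&` _); apply: eq_follows => j.
  by rewrite leq_eqVlt /zy => /predU1P[->|]; [rewrite ltnn|rewrite ltnS => ->].
by apply: (psumr_eq0P _ p0) => // y _; exact: mass_ge0.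
Qed.

Lemma markov_M2_after m x : (1 <= m)%N ->
  markov_on pr (fun k => M2 (m + k)%N) (past R M1 m x)
    (term_kernel (trans1 P U Q2)).
Proof.
move=> m1 l z.
have [[k kl zk]|noE] := pselect (exists2 k, (k <= l)%N & is_E (z k)).
  rewrite !M2_avoids_E ?mul0r//; last by exists k => //; exact: leqW.
  by exists k.
have zS k : (k <= l)%N -> ~~ is_E (z k).
  by move=> kl; apply/negP => zk; apply: noE; exists k.
have [zl|zl] := boolP (is_E (z l.+1)); last first.
  apply: law_M2_after => // k; rewrite leq_eqVlt => /predU1P[->//|].
  by rewrite ltnS => /zS.
rewrite M2_avoids_E//; last by exists l.+1.
by move: zl; case: (z l.+1) => [[e|]|]// _; rewrite kernel_to_E ?mulr0// zS.
Qed.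

(** * The two formulas *)

(** Both chains are observed up to the common horizon [(z1 + z2).+1], because
their conditional independence is given for equal horizons. *)
Lemma mass_past_dies m z1 z2 x s : (1 <= m)%N -> x m = Some (inr s) ->
  mass (past R M1 m x `&`
    (box (fun k => M1 (m + k)%N) (z1 + z2).+1 (dies_at z1.+1) `&`
     box (fun k => M2 (m + k)%N) (z1 + z2).+1 (dies_at z2.+1))) =
  mass (past R M1 m x) *
    hadamard (Q1 ^+ z1 *m exit_vec Q1) (Q2 ^+ z2 *m exit_vec Q2)
      (enum_rank s) 0.
Proof.
move=> m1 xm.
have mM1' k y : measurable [set w | M1 (m + k)%N w = y] by exact: mM1.
have mM2' k y : measurable [set w | M2 (m + k)%N w = y] by exact: mM2.
have mA := measurable_past x m1.
set A := past R M1 m x in mA *; set F := box _ _ _; set G := box _ _ _.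
have A1 : A `<=` [set w | M1 (m + 0)%N w = Some (inr s)].
  by move=> w [_ xw]; rewrite /= addn0 xw.
have A2 : A `<=` [set w | M2 (m + 0)%N w = Some (inr s)].
  by move=> w pw; rewrite /= addn0 (M2_at_exit pw)// -(addn0 m); exact: A1.
have F1 : mass (A `&` F) = mass A * (Q1 ^+ z1 *m exit_vec Q1) (enum_rank s) 0.
  apply: (mass_dies mM1' mA A1 (markov_M1_after x m1)).
  by rewrite ltnS leq_addr.
have G1 : mass (A `&` G) = mass A * (Q2 ^+ z2 *m exit_vec Q2) (enum_rank s) 0.
  apply: (mass_dies mM2' mA A2 (markov_M2_after x m1)).
  by rewrite ltnS leq_addl.
have mF : measurable F by exact: measurable_box.
have mG : measurable G by exact: measurable_box.
have FG : mass A * mass (A `&` (F `&` G)) = mass (A `&` F) * mass (A `&` G).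
  apply: indep_box => // y z; apply: EFin_inj; rewrite !EFinM -!massE//.
  - exact: (cc_indep hM).
  - by apply: measurableI => //; exact: measurable_follows.
  - by apply: measurableI => //; exact: measurable_follows.
  - by do 2?apply: measurableI => //; exact: measurable_follows.
(* Independence is only given after multiplication by [mass A]. *)
rewrite mxE; have [A0|A0] := eqVneq (mass A) 0.
  rewrite A0 mul0r; apply/eqP; rewrite eq_le mass_ge0 andbT -A0.
  apply: le_mass => //; exact/measurableI/measurableI.
by apply: (mulfI A0); rewrite FG F1 G1 mulrACA !mulrA.
Qed.

Lemma sube_natE (r t : \bar R) m n : r = (m%:R)%:E ->
  (t - r)%E = (n%:R)%:E <-> t = ((m + n)%:R)%:E.
Proof.
move=> ->; case: t => [t||] //=; rewrite natrD; split=> [[<-]|[->]].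
  by congr EFin; rewrite addrCA subrr addr0.
by congr EFin; rewrite addrAC subrr add0r.
Qed.

Lemma psiE m z1 z2 :
  psi pr M1 M2 m z1 z2 = pr [set w | [/\ tau12 R M1 w = (m%:R)%:E,
    tau R M1 w = ((m + z1)%:R)%:E & tau R M2 w = ((m + z2)%:R)%:E]].
Proof.
rewrite /psi; congr (pr _); apply/seteqP; split=> w [t12 t1 t2]; split=> //.
- exact/(sube_natE _ _ t12).
- exact/(sube_natE _ _ t12).
- exact/(sube_natE _ _ t12).
- exact/(sube_natE _ _ t12).
Qed.

(** On [tau12 = m] both chains are alive before [m], so dying at [m + z] only
constrains the coordinates from [m] on. *)
Lemma psi_box m z1 z2 : (1 <= m)%N ->
  [set w | [/\ tau12 R M1 w = (m%:R)%:E,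
    tau R M1 w = ((m + z1.+1)%:R)%:E & tau R M2 w = ((m + z2.+1)%:R)%:E]] =
  box (fun k => M1 (m + k)%N) (z1 + z2).+1 (dies_at z1.+1) `&`
  box (fun k => M2 (m + k)%N) (z1 + z2).+1 (dies_at z2.+1) `&`
  box M1 m (exits_at is_E m).
Proof.
move=> m1; rewrite -tau12_box//.
have tauE (M : nat -> Om -> option (E + S)) z w : (z <= z1 + z2)%N ->
    (forall k, (1 <= k)%N -> (k < m)%N -> isSome (M k w)) ->
    tau R M w = ((m + z.+1)%:R)%:E <->
    box (fun k => M (m + k)%N) (z1 + z2).+1 (dies_at z.+1) w.
  move=> zz Mm; rewrite /tau exit_timeP; split.
    move=> [_ dead alive] k _; apply/andP; split; apply/implyP.
      move=> kz; apply/is_someP; apply: alive; first exact: ltn_addr.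
      by rewrite ltn_add2l.
    by move=> /eqP ->; apply/negP; rewrite -is_someP.
  move=> Bw; split; first exact: ltn_addr.
    rewrite is_someP; apply/negP.
    by have := Bw z.+1 zz; rewrite /dies_at ltnn eqxx.
  move=> k k1 kmz; rewrite is_someP; have [km|mk] := ltnP k m; first exact: Mm.
  have kz : (k - m < z.+1)%N by rewrite ltn_subLR.
  have := Bw (k - m)%N (leq_trans (ltnW kz) (zz : z.+1 <= _.+1)%N).
  by rewrite /dies_at kz subnKC// => /andP[].
have alive1 w : tau12 R M1 w = (m%:R)%:E ->
    forall k, (1 <= k)%N -> (k < m)%N -> isSome (M1 k w).
  move=> /exit_timeP[_ _ EM] k k1 km; have [e ->//] := EM k k1 km.
have alive2 w : tau12 R M1 w = (m%:R)%:E ->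
    forall k, (1 <= k)%N -> (k < m)%N -> isSome (M2 k w).
  move=> t12 k k1 km; rewrite (cc_common hM); first exact: alive1.
  by rewrite t12 lee_fin ler_nat ltnW.
apply/seteqP; split=> w.
  move=> [t12 t1 t2]; split=> //; split.
    by apply/tauE => //; [exact: leq_addr|exact: alive1].
  by apply/tauE => //; [exact: leq_addl|exact: alive2].
move=> [[d1 d2] t12]; split=> //.
  by apply/tauE => //; [exact: leq_addr|exact: alive1].
by apply/tauE => //; [exact: leq_addl|exact: alive2].
Qed.

Lemma psi_formula m z1 z2 : (1 <= m)%N -> (1 <= z1)%N -> (1 <= z2)%N ->
  psi pr M1 M2 m z1 z2 =
  ((alpha *m P ^+ (m - 1) *m U *m
     hadamard (Q1 ^+ (z1 - 1) *m exit_vec Q1)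
              (Q2 ^+ (z2 - 1) *m exit_vec Q2)) 0 0)%:E.
Proof.
case: m z1 z2 => // m [//|z1] [//|z2] m1 _ _; rewrite !subn1/=.
rewrite psiE psi_box//; set F := box _ _ _; set G := box _ _ _.
have mF : measurable F by apply: measurable_box => k; exact: mM1.
have mG : measurable G by apply: measurable_box => k; exact: mM2.
have mFG : measurable (F `&` G) by exact: measurableI.
rewrite massE; last by apply: measurableI => //; exact: measurable_box.
congr EFin; rewrite mass_box//.
set H := hadamard _ _.
pose g (y : option (E + S)) :=
  if y is Some (inr s) then H (enum_rank s) 0 else 0.
(* The weight of a past only depends on the state [path_of f m.+1] reached at
   the exit, which is what [sum_path_last] exploits. *)
transitivity (\sum_(f : {ffun 'I_m.+2 -> option (E + S)}
     | [forall k : 'I_m.+2, exits_at is_E m.+1 k (f k)])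
   mass (setT `&` follows M1 m.+1 (path_of f)) * g (path_of f m.+1)).
  apply: eq_bigr => f /forallP fB.
  have fB' k : (k <= m.+1)%N -> exits_at is_E m.+1 k (path_of f k).
    by move=> km; have := fB (inord k); rewrite inordK.
  rewrite setTI -past_follows// setIC.
  case fm : (path_of f m.+1) => [[e|s]|] /=.
  - by have := fB' _ (leqnn _); rewrite fm /exits_at ltnn andbF eqxx.
  - exact: mass_past_dies.
  rewrite mulr0 (_ : _ `&` _ = set0) ?mass0//; apply/seteqP; split=> // w.
  move=> [[_ fw] [Fw _]]; have := Fw 0%N isT.
  by rewrite /= addn0 fw// fm.
rewrite (sum_path_last pr mM1 _ _ _ measurableT) sum_states mulr0 add0r.
rewrite big1 ?add0r => [|j _]; last by rewrite mulr0.
rewrite mxE; apply: eq_bigr => j _.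
by rewrite (box_mass_exit m).2 /g enum_valK.
Qed.

Lemma exit_at_None m : (1 <= m)%N ->
  mass (setT `&` [set w | M1 m w = None] `&` [set w | tau12 R M1 w = (m%:R)%:E])
  = 0.
Proof.
by case: m => // m m1; rewrite tau12_box//; exact: (box_mass_exit m).1.
Qed.

Lemma joint_formula n1 n2 : (2 <= n1)%N -> (2 <= n2)%N ->
  joint_pmf pr M1 M2 n1 n2 =
  (\sum_(1 <= m < minn n1 n2) psi pr M1 M2 m (n1 - m) (n2 - m))%E.
Proof.
move=> n1_2 n2_2; rewrite /joint_pmf; set J := [set w | _ /\ _].
have n1_1 := ltnW n1_2; have n2_1 := ltnW n2_2.
pose T m := [set w | tau12 R M1 w = (m%:R)%:E].
have mT m : measurable (T m).
  case: m => [|m]; last by rewrite /T tau12_box//; exact: measurable_box.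
  rewrite (_ : T 0%N = set0)//; apply/seteqP; split=> // w.
  by move=> /exit_timeP[].
have mJ : measurable J.
  rewrite (_ : J = [set w | tau R M1 w = (n1%:R)%:E] `&`
                   [set w | tau R M2 w = (n2%:R)%:E])//.
  by rewrite !tau_box//; apply: measurableI; exact: measurable_box.
have mJT m : measurable (J `&` T m) by exact: measurableI.
have JT : J = \bigcup_(m in [set` [pred m : 'I_n1.+1 | (0 < m)%N]]) (J `&` T m).
  apply/seteqP; split=> [w Jw|w [m _ []]//].
  have [t1 t2] := Jw; move: t1 => /exit_timeP[_ dead _].
  have ex : exists k, (0 < k)%N && ~~ is_E (M1 k w).
    exists n1; rewrite n1_1; apply: contra_notN dead => /is_EP[e ->].
    by exists (inl e).
  case: (ex_minnP ex) => m /andP[m0 mE] minm.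
  have mn1 : (m < n1.+1)%N.
    apply: minm; rewrite n1_1; apply: contra_notN dead => /is_EP[e ->].
    by exists (inl e).
  exists (Ordinal mn1) => //; split=> //; apply/exit_timeP; split=> //.
    by rewrite is_EP; exact/negP.
  move=> k k0 km; rewrite is_EP; apply: contraTT km => kE.
  by rewrite -leqNgt; apply: minm; rewrite k0.
(* If [m = n1], then [M1] terminates directly from [E], a null event.  If
   [n2 <= m < n1], then [M1] is alive at time [n2], and so is [M2], which agrees
   with it up to time [m]: the event is empty. *)
have null m : (1 <= m)%N -> (minn n1 n2 <= m)%N -> (m <= n1)%N ->
    mass (J `&` T m) = 0.
  move=> m1 mn mn1; apply/eqP; rewrite eq_le mass_ge0 andbT.
  rewrite -(exit_at_None m1); apply: le_mass => //.
    by apply: measurableI; [rewrite setTI|exact: mT].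
  move=> w [[/exit_timeP[_ dead1 alive1] /exit_timeP[_ dead2 _]] t12].
  split=> //; split=> //=.
  move: dead1 dead2; rewrite !is_someP => dead1 dead2.
  have noneP y : ~ isSome y -> y = None :> option (E + S) by case: y.
  have [mn1'|mn1'] := eqVneq m n1; first by apply: noneP; rewrite mn1'.
  have ltmn1 : (m < n1)%N by rewrite ltn_neqAle mn1' mn1.
  have n2m : (n2 <= m)%N by move: mn; rewrite geq_min leqNgt ltmn1.
  have M12 : M2 n2 w = M1 n2 w.
    by apply: (cc_common hM); rewrite t12 lee_fin ler_nat.
  have : isSome (M1 n2 w).
    by apply/is_someP/alive1 => //; exact: leq_ltn_trans ltmn1.
  by rewrite -M12.
rewrite massE// {1}JT mass_sum//; last first.
  move=> i j w [_ ti] [_ tj]; apply/val_inj/eqP.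
  by rewrite -(eqr_nat R) -eqe -ti tj.
have psiJT m : (1 <= m)%N -> (m < minn n1 n2)%N ->
    psi pr M1 M2 m (n1 - m) (n2 - m) = (mass (J `&` T m))%:E.
  move=> m1; rewrite leq_min => /andP[/ltnW mn1 /ltnW mn2].
  rewrite psiE !subnKC// -massE//; congr (pr _).
  by apply/seteqP; split=> w [] // [].
rewrite big_nat (eq_bigr (fun m => (mass (J `&` T m))%:E)); last first.
  by move=> m /andP[m1 mn]; exact: psiJT.
rewrite -big_nat sumEFin; congr EFin.
rewrite -(big_mkord (fun m => (0 < m)%N) (fun m => mass (J `&` T m))).
rewrite big_mkcond big_ltn//= add0r.
rewrite (big_cat_nat _ (n := minn n1 n2))/=; last 2 first.
- by rewrite leq_min n1_1.
- by rewrite (leq_trans (geq_minl _ _)).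
rewrite [X in _ + X]big_nat [X in _ + X]big1 ?addr0 => [|m /andP[mn mn1]].
  by rewrite big_nat [RHS]big_nat; apply: eq_bigr => m /andP[-> _].
have m1 : (1 <= m)%N by apply: leq_trans mn; rewrite leq_min n1_1.
by rewrite m1 null.
Qed.

End Coupled.

Theorem proposition2p1 (R : realType) (E S : finType)
  (hE : (0 < #|E|)%N) (hS : (0 < #|S|)%N)
  (alpha : 'rV[R]_#|E|) (P : 'M[R]_#|E|) (U : 'M[R]_(#|E|, #|S|))
  (Q1 Q2 : 'M[R]_#|S|)
  (halpha : prob_row alpha) (hP : subprob_mx P) (hU : nonneg_mx U)
  (hPU : forall i, \sum_j row_mx P U i j = 1)
  (hQ1 : subprob_mx Q1) (hQ2 : subprob_mx Q2)
  (tP : terminates P) (tQ1 : terminates Q1) (tQ2 : terminates Q2)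
  (* the chains with initial vector alpha *)
  (d : measure_display) (Om : measurableType d) (pr : probability Om R)
  (M1 M2 : nat -> Om -> option (E + S))
  (hM : coupled_chains alpha P U Q1 Q2 pr M1 M2)
  (* for each i, the chains started from the state i *)
  (di : E -> measure_display) (Omi : forall i : E, measurableType (di i))
  (pri : forall i : E, probability (Omi i) R)
  (M1i M2i : forall i : E, nat -> Omi i -> option (E + S))
  (hMi : forall i : E,
    coupled_chains (unit_row R i) P U Q1 Q2
      (pri i) (M1i i) (M2i i)) :
  [/\ forall n1 n2 : nat, (2 <= n1)%N -> (2 <= n2)%N ->
        joint_pmf pr M1 M2 n1 n2 =
        (\sum_(1 <= m < minn n1 n2) psi pr M1 M2 m (n1 - m) (n2 - m))%E,
      forall (i : E) (n1 n2 : nat), (2 <= n1)%N -> (2 <= n2)%N ->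
        joint_pmf (pri i) (M1i i) (M2i i) n1 n2 =
        (\sum_(1 <= m < minn n1 n2)
           psi (pri i) (M1i i) (M2i i) m (n1 - m) (n2 - m))%E,
      forall m z1 z2 : nat, (1 <= m)%N -> (1 <= z1)%N -> (1 <= z2)%N ->
        psi pr M1 M2 m z1 z2 =
        ((alpha *m P ^+ (m - 1) *m U *m
           hadamard (Q1 ^+ (z1 - 1) *m exit_vec Q1)
                    (Q2 ^+ (z2 - 1) *m exit_vec Q2)) 0 0)%:E &
      forall (i : E) (m z1 z2 : nat),
        (1 <= m)%N -> (1 <= z1)%N -> (1 <= z2)%N ->
        psi (pri i) (M1i i) (M2i i) m z1 z2 =
        ((unit_row R i *m P ^+ (m - 1) *m U *m
           hadamard (Q1 ^+ (z1 - 1) *m exit_vec Q1)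
                    (Q2 ^+ (z2 - 1) *m exit_vec Q2)) 0 0)%:E].
Proof.
have unit_prob (i : E) : prob_row (unit_row R i).
  split=> [j|]; first by rewrite mxE ler0n.
  rewrite (bigD1 (enum_rank i))//= mxE !eqxx big1 ?addr0// => j ji.
  by rewrite mxE (negbTE ji) andbF.
split=> [n1 n2|i n1 n2|m z1 z2|i m z1 z2].
- exact: (joint_formula halpha hPU hM).
- exact: (joint_formula (unit_prob i) hPU (hMi i)).
- exact: (psi_formula halpha hPU hM).
- exact: (psi_formula (unit_prob i) hPU (hMi i)).
Qed.
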